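(* Let $d=2^n$ and let $A,B,C,D$ be $n$-qubit Pauli operators with $A,B,C,D\ne I$, $AC\neq I$ and $BD\ne I$. Then the average of the commutator-type eight-point out-of-time-order correlator over the $n$-qubit Clifford group is $$\langle A\tilde BC\tilde DA^\dagger\tilde D^\dagger C^\dagger\tilde B^\dagger\rangle_{\mathrm{Clifford}}=\frac{-K(A,C^\dagger)}{d^2-1},$$ where $K(P,Q)\in\{1,-1\}$ is the scalar defined for Pauli operators $P,Q$ by $Q^\dagger PQ=K(P,Q)\,P$.
   Context: $n$-qubit Pauli operators are the $4^n=d^2$ operators $P_1\otimes\cdots\otimes P_n$ with each $P_j\in\{I,X,Y,Z\}$ (no global phases). The $n$-qubit Clifford group consists of the unitaries on $(\mathbb{C}^2)^{\otimes n}$ that map each Pauli operator to a Pauli operator up to a phase under conjugation; modulo global phases it is a finite group, and $\langle\cdot\rangle_{\mathrm{Clifford}}$ denotes the uniform average over this finite group of $\frac1d\mathrm{tr}\{A\tilde BC\tilde DA^\dagger\tilde D^\dagger C^\dagger\tilde B^\dagger\}$, where $\tilde O=U^\dagger OU$ and $U$ is the Clifford element. *)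

(* Defs.v *)
From mathcomp Require Import all_boot all_order all_algebra.
From mathcomp Require Import complex mxtens.
From mathcomp Require Import finmap all_classical reals.

Set Implicit Arguments.
Unset Strict Implicit.
Unset Printing Implicit Defensive.

Import Order.TTheory GRing.Theory Num.Theory.

Local Open Scope ring_scope.
Local Open Scope sesquilinear_scope.
Local Open Scope complex_scope.
Local Open Scope classical_set_scope.

(* The ambient space (C^2)^{\otimes n} is C^(2^n) with the Kronecker-product
   basis, so operators are 'M[R[i]]_(2 ^ n) and the adjoint is M^t*. *)

Definition pauliX (R : realType) : 'M[R[i]]_2 :=
  \matrix_(j, k) (j != k)%:R.

Definition pauliY (R : realType) : 'M[R[i]]_2 :=
  \matrix_(j, k) (if (j < k)%N then - 'i else if (k < j)%N then 'i else 0).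

Definition pauliZ (R : realType) : 'M[R[i]]_2 :=
  \matrix_(j, k) (if j == k then (-1) ^+ j else 0).

(* s 0 \otimes s 1 \otimes ... \otimes s (n - 1); the cast is along
   2 ^ n.+1 = 2 * 2 ^ n. *)
Fixpoint tensor (R : realType) (n : nat) :
    ('I_n -> 'M[R[i]]_2) -> 'M[R[i]]_(2 ^ n) :=
  if n is m.+1 then fun s =>
    castmx (esym (expnS 2 m), esym (expnS 2 m))
      (s ord0 *t tensor (fun j : 'I_m => s (lift ord0 j)))
  else fun _ => 1%:M.

Definition pauli (R : realType) (n : nat) : set 'M[R[i]]_(2 ^ n) :=
  [set P | exists2 s : 'I_n -> 'M[R[i]]_2,
     forall j, s j \in [:: 1%:M; pauliX R; pauliY R; pauliZ R]
     & P = tensor s].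

(* \tilde O = U^\dagger O U *)
Definition heisenberg (R : realType) (n : nat) (U O : 'M[R[i]]_(2 ^ n)) :
    'M[R[i]]_(2 ^ n) :=
  U^t* *m O *m U.

Definition clifford (R : realType) (n : nat) : set 'M[R[i]]_(2 ^ n) :=
  [set U | U \is unitarymx /\
     forall P, pauli P -> exists c : R[i], exists Q,
       [/\ `|c| = 1, pauli Q & heisenberg U P = c *: Q]].

(* The class of U modulo global phases, i.e. its coset U(1) U. *)
Definition phase_class (R : realType) (n : nat) (U : 'M[R[i]]_(2 ^ n)) :
    set 'M[R[i]]_(2 ^ n) :=
  [set V | exists2 c : R[i], `|c| = 1 & V = c *: U].

(* The underlying set of the Clifford group modulo global phases. *)
Definition proj_clifford (R : realType) (n : nat) :
    set (set 'M[R[i]]_(2 ^ n)) :=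
  [set phase_class U | U in @clifford R n].

(* Uniform average of f over the finite set proj_clifford; a phase-invariant f
   is evaluated at an arbitrary representative of each class. Were
   proj_clifford infinite, the value would be 0, so a nonzero average also
   asserts finiteness. *)
Definition clifford_avg (R : realType) (n : nat)
    (f : 'M[R[i]]_(2 ^ n) -> R[i]) : R[i] :=
  (\sum_(c \in @proj_clifford R n) f (xget 0 c))
    / #|` fset_set (@proj_clifford R n)|%:R.

(* (1/d) tr(A ~B C ~D A^\dagger ~D^\dagger C^\dagger ~B^\dagger) *)
Definition otoc8 (R : realType) (n : nat) (A B C D U : 'M[R[i]]_(2 ^ n)) :
    R[i] :=
  (2 ^ n)%:R^-1 *
  \tr (A *m heisenberg U B *m C *m heisenberg U D *m
       A^t* *m (heisenberg U D)^t* *m C^t* *m (heisenberg U B)^t*).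

(* clifford_avg (otoc8 A B C D) is independent of the representatives. *)
Lemma otoc8_phase (R : realType) (n : nat) (A B C D U V : 'M[R[i]]_(2 ^ n)) :
  phase_class U V -> otoc8 A B C D V = otoc8 A B C D U.
Proof.
case=> c c1 ->; suff hE O : heisenberg (c *: U) O = heisenberg U O.
  by rewrite /otoc8 !hE.
have hadj : (c *: U)^t* = Num.conj c *: U^t*.
  by apply/matrixP => j k; rewrite !mxE rmorphM.
rewrite /heisenberg hadj -!scalemxAl -scalemxAr scalerA.
by rewrite -normCKC c1 expr1n scale1r.
Qed.

(* K(P, Q): the k in {1, -1} with Q^\dagger P Q = k P (unique as soon as
   P != 0, and existing for Pauli operators). *)
Definition pauliK (R : realType) (n : nat) (P Q : 'M[R[i]]_(2 ^ n)) : R[i] :=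
  xget 0 [set k | (k = 1 \/ k = -1) /\ Q^t* *m P *m Q = k *: P].

(* Main.v *)
Require Import Defs.
From mathcomp Require Import all_boot all_order all_algebra.
From mathcomp Require Import complex mxtens.
From mathcomp Require Import finmap all_classical reals ring.

Import Order.TTheory GRing.Theory Num.Theory.

Local Open Scope ring_scope.
Local Open Scope sesquilinear_scope.
Local Open Scope complex_scope.
Local Open Scope classical_set_scope.

(* Index the Paulis by binary vectors s, with commutation sign sgn s t = +-1 a
   symmetric bicharacter that is nontrivial in s as soon as s != 0. For Clifford
   U, pulling all signs out of the eight-point word leaves
   K(A, C^dagger) * sgn(A, ~(BD)), so only the four-point correlator of A and BD
   has to be averaged. Its sum over all Paulis O in place of BD vanishes by
   character orthogonality, O = I contributes 1, and the average does not depend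
   on O != I: any two nonidentity Paulis anticommute with a common third one,
   and anticommuting Paulis are exchanged by a Clifford element. Hence
   each O != I contributes -1 / (d^2 - 1). The projective Clifford group is
   finite since the signed permutation of the Paulis determines U up to phase,
   the commutant of the Paulis being the scalars. *)

(** * Single-qubit Paulis and their multiplication table *)

Definition pauli1 (R : realType) (x : bool * bool) : 'M[R[i]]_2 :=
  if x.1 then if x.2 then pauliY R else pauliX R
  else if x.2 then pauliZ R else 1%:M.

(** The two bits of an index are the exponents of X and Z, with Y at (1,1). This is the standard
    symplectic form on $F_2^2$, written as a sign. *)
Definition sgn1 (R : realType) (x y : bool * bool) : R[i] :=
  (-1) ^+ ((x.1 && y.2) (+) (x.2 && y.1)).

Definition phase1 (R : realType) (x y : bool * bool) : R[i] :=
  match x, y with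
  | (true, false), (false, true) | (true, true), (true, false)
  | (false, true), (true, true) => - 'i
  | (true, false), (true, true) | (true, true), (false, true)
  | (false, true), (true, false) => 'i
  | _, _ => 1
  end.

(** Addition of bits is exclusive or, so multiplying Paulis adds their indices up to a phase; the
    sixteen products are checked entrywise. *)
Lemma pauli1M (R : realType) x y :
  pauli1 R x *m pauli1 R y = phase1 R x y *: pauli1 R (x + y).
Proof.
case: x => [[] []]; case: y => [[] []]; apply/matrixP => j k;
  rewrite !mxE !big_ord_recl big_ord0 /pauli1 /phase1 /=;
  case: j => [[|[|?]] //= ?]; case: k => [[|[|?]] //= ?]; 
  rewrite !mxE /= ?complexiE;
  by rewrite ?(mulr0, mul0r, mulr1, mul1r, add0r, addr0, mulrN, mulNr, mulCii,
               opprK).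
Qed.

Lemma pauli1_adj (R : realType) x : (pauli1 R x)^t* = pauli1 R x.
Proof.
case: x => [[] []]; apply/matrixP => j k; rewrite /pauli1 !mxE /=;
  case: j => [[|[|?]] //= ?]; case: k => [[|[|?]] //= ?];
  by rewrite ?complexiE ?rmorphN /= ?conjCi ?conjC1 ?conjC0 ?rmorph1 ?rmorph0 ?opprK.
Qed.

Lemma pauli1_mem (R : realType) x :
  pauli1 R x \in [:: 1%:M; pauliX R; pauliY R; pauliZ R].
Proof. by case: x => [[] []]; rewrite !inE eqxx ?orbT. Qed.

Lemma mem_pauli1 (R : realType) M :
  M \in [:: 1%:M; pauliX R; pauliY R; pauliZ R] -> exists x, M = pauli1 R x.
Proof.
rewrite !inE => /or4P[] /eqP ->.
- by exists (false, false).
- by exists (true, false).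
- by exists (true, true).
- by exists (false, true).
Qed.

Lemma norm_phase1 (R : realType) x y : `|phase1 R x y| = 1.
Proof.
by case: x => [[] []]; case: y => [[] []] /=;
  rewrite ?normrN ?complexiE ?normCi ?normr1.
Qed.

Lemma phase1C (R : realType) x y : phase1 R x y = sgn1 R x y * phase1 R y x.
Proof.
by case: x => [[] []]; case: y => [[] []];
  rewrite /sgn1 /= ?expr1 ?expr0 ?mul1r ?mulN1r ?opprK.
Qed.

Lemma phase1xx (R : realType) x : phase1 R x x = 1.
Proof. by case: x => [[] []]. Qed.

Lemma sgn1D (R : realType) x y z : sgn1 R x (y + z) = sgn1 R x y * sgn1 R x z.
Proof.
rewrite /sgn1 -signr_addb; congr (_ ^+ _).
by case: x => [[] []]; case: y => [[] []]; case: z => [[] []].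
Qed.

Lemma sgn1C (R : realType) x y : sgn1 R x y = sgn1 R y x.
Proof. by case: x => [[] []]; case: y => [[] []]. Qed.

Lemma sgn1_nontrivial (R : realType) x :
  x != 0 -> exists y, sgn1 R x y = -1.
Proof.
by case: x => [[] []] // _; [exists (true, false) | exists (false, true)
  | exists (true, false)]; rewrite /sgn1 expr1.
Qed.

(** * Algebra of n-fold tensor products *)

Lemma eq_tensor {R : realType} {n} (s t : 'I_n -> 'M[R[i]]_2) :
  s =1 t -> tensor s = tensor t.
Proof. by move=> /funext ->. Qed.

Lemma tensorS (R : realType) n (s : 'I_n.+1 -> 'M[R[i]]_2) :
  tensor s = castmx (esym (expnS 2 n), esym (expnS 2 n))
      (s ord0 *t tensor (fun j : 'I_n => s (lift ord0 j))).
Proof. by []. Qed.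

Lemma castmxM (R : pzRingType) m n (e : m = n) (M N : 'M[R]_m) :
  castmx (e, e) M *m castmx (e, e) N = castmx (e, e) (M *m N).
Proof. by case: n / e. Qed.

Lemma castmxZ (R : pzRingType) m n (e : m = n) a (M : 'M[R]_m) :
  castmx (e, e) (a *: M) = a *: castmx (e, e) M.
Proof. by case: n / e. Qed.

Lemma castmxD (R : pzRingType) m n (e : m = n) (M N : 'M[R]_m) :
  castmx (e, e) (M + N) = castmx (e, e) M + castmx (e, e) N.
Proof. by case: n / e. Qed.

Lemma tensorM (R : realType) n (s t : 'I_n -> 'M[R[i]]_2) :
  tensor s *m tensor t = tensor (fun j => s j *m t j).
Proof.
elim: n s t => [|n IH] s t; first exact: mul1mx.
by rewrite !tensorS castmxM tensmx_mul IH.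
Qed.

Lemma tensorZ (R : realType) n (c : 'I_n -> R[i]) (s : 'I_n -> 'M[R[i]]_2) :
  tensor (fun j => c j *: s j) = (\prod_j c j) *: tensor s.
Proof.
elim: n c s => [|n IH] c s; first by rewrite big_ord0 scale1r.
rewrite !tensorS IH big_ord_recl -castmxZ; congr (castmx _ _).
by apply/matrixP => j k; rewrite !mxE mulrACA.
Qed.

Lemma tensor_adj (R : realType) n (s : 'I_n -> 'M[R[i]]_2) :
  (tensor s)^t* = tensor (fun j => (s j)^t*).
Proof.
elim: n s => [|n IH] s; first by rewrite /= trmx1 map_mx1.
by rewrite !tensorS trmx_cast map_castmx trmx_tens map_mxT IH.
Qed.

Lemma tensor1 (R : realType) n : tensor (fun _ : 'I_n => 1%:M : 'M[R[i]]_2) = 1%:M.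
Proof.
elim: n => [|n IH] //; rewrite tensorS IH.
have -> : (1%:M : 'M[R[i]]_2) *t (1%:M : 'M[R[i]]_(2 ^ n)) = 1%:M.
  apply/matrixP => j k; case: (mxtens_indexP j) => j0 j1.
  case: (mxtens_indexP k) => k0 k1; rewrite tensmxE !mxE -natrM mulnb.
  by rewrite (can_eq (@mxtens_indexK _ _)) xpair_eqE.
by move: (esym _) => e; case: _ / e.
Qed.

(** * The n-qubit Paulis, indexed by binary vectors *)

Notation pidx n := {ffun 'I_n -> bool * bool}.

(** Finite functions as indices give both a finite type to sum over and the additive group
    $F_2^{2n}$. *)
Definition sigma (R : realType) n (s : pidx n) : 'M[R[i]]_(2 ^ n) :=
  tensor (fun j => pauli1 R (s j)).

Definition sgn (R : realType) n (s t : pidx n) : R[i] :=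
  \prod_j sgn1 R (s j) (t j).

Definition phase (R : realType) n (s t : pidx n) : R[i] :=
  \prod_j phase1 R (s j) (t j).

Arguments sigma R {n} s.
Arguments sgn R {n} s t.
Arguments phase R {n} s t.

Lemma pauliP (R : realType) n (P : 'M[R[i]]_(2 ^ n)) :
  pauli P <-> exists s, P = sigma R s.
Proof.
split=> [[s hs ->]|[s ->]]; last first.
  by exists (fun j => pauli1 R (s j)) => // j; exact: pauli1_mem.
have [x hx] := choice (fun j => mem_pauli1 _ _ (hs j)).
by exists [ffun j => x j]; apply: eq_tensor => j; rewrite ffunE.
Qed.

Lemma sigmaM (R : realType) n (s t : pidx n) :
  sigma R s *m sigma R t = phase R s t *: sigma R (s + t).
Proof.
rewrite tensorM -tensorZ; apply: eq_tensor => j.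
by rewrite pauli1M ffunE.
Qed.

Lemma sigma_adj (R : realType) n (s : pidx n) : (sigma R s)^t* = sigma R s.
Proof. by rewrite tensor_adj; apply: eq_tensor => j; rewrite pauli1_adj. Qed.

Lemma sigma0 (R : realType) n : sigma R (0 : pidx n) = 1%:M.
Proof. by rewrite -tensor1; apply: eq_tensor => j; rewrite ffunE. Qed.

Lemma pidx_addxx n (s : pidx n) : s + s = 0.
Proof. by apply/ffunP => j; rewrite !ffunE; case: (s j) => [[] []]. Qed.

Lemma pidx_add_eq0 n (s t : pidx n) : (s + t == 0) = (s == t).
Proof. by rewrite addr_eq0 -[in RHS](addr0 t) -(subrr t) addrA pidx_addxx add0r. Qed.

Lemma norm_phase (R : realType) n (s t : pidx n) : `|phase R s t| = 1.
Proof. by rewrite normr_prod big1 // => j _; rewrite norm_phase1. Qed.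

Lemma sigma_sq (R : realType) n (s : pidx n) : sigma R s *m sigma R s = 1%:M.
Proof.
rewrite sigmaM pidx_addxx sigma0 /phase big1 ?scale1r // => j _.
exact: phase1xx.
Qed.

Lemma sigma_comm (R : realType) n (s t : pidx n) :
  sigma R s *m sigma R t = sgn R s t *: (sigma R t *m sigma R s).
Proof.
rewrite !sigmaM scalerA [t + s]addrC; congr (_ *: _).
by rewrite -big_split; apply: eq_bigr => j _; exact: phase1C.
Qed.

(** * The commutation sign as a character, and its orthogonality relation *)

Lemma sgnD (R : realType) n (s t u : pidx n) :
  sgn R s (t + u) = sgn R s t * sgn R s u.
Proof.
by rewrite -big_split; apply: eq_bigr => j _; rewrite ffunE sgn1D.
Qed.

Lemma sgnC (R : realType) n (s t : pidx n) : sgn R s t = sgn R t s.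
Proof. by apply: eq_bigr => j _; exact: sgn1C. Qed.

Lemma sgn_pm1 (R : realType) n (s t : pidx n) : sgn R s t = 1 \/ sgn R s t = -1.
Proof.
apply: (big_ind (fun c : R[i] => c = 1 \/ c = -1)); first by left.
- by move=> _ _ [->|->] [->|->]; rewrite ?mulN1r ?mul1r ?opprK; auto.
by move=> j _; rewrite /sgn1; case: (_ (+) _); auto.
Qed.

Lemma sgn_nontrivial (R : realType) n (s : pidx n) :
  s != 0 -> exists t, sgn R s t = -1.
Proof.
move=> /eqP s0; have [j sj0] : exists j, s j != 0.
  apply: contrapT => /forallNP h; apply: s0; apply/ffunP => j; rewrite ffunE.
  exact/eqP/negPn/negP/h.
have [y hy] := sgn1_nontrivial R _ sj0.
(* One anticommuting factor at a qubit where [s] is nontrivial, identities elsewhere. *)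
exists [ffun k => if k == j then y else 0].
rewrite /sgn (bigD1 j) //= ffunE eqxx hy big1 ?mulr1 // => k /negPf kj.
by rewrite ffunE kj /sgn1 !andbF expr0.
Qed.

Lemma sum_sgn (R : realType) n (s : pidx n) :
  s != 0 -> \sum_t sgn R s t = 0.
Proof.
move=> /(sgn_nontrivial R) [u hu].
(* Translation by [u], whose sign with [s] is -1, turns the sum into its own negative. *)
apply/eqP; rewrite -eqNr -sumrN [eqbRHS](reindex_inj (addrI u)).
by apply/eqP/eq_bigr => t _; rewrite sgnD hu mulN1r.
Qed.

(** For distinct [s] and [t], the product $(1-sgn(s,u))(1-sgn(t,u))$ is nonzero only at the desired
    [u]. Without such a [u] its sum over [u] is 0. Expanded, it leaves the number of indices, since
    the characters of [s], [t] and [s + t] are all nontrivial and sum to 0. *)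
Lemma sgn_separate (R : realType) n (s t : pidx n) :
  s != 0 -> t != 0 -> exists u, sgn R s u = -1 /\ sgn R t u = -1.
Proof.
move=> s0 t0; apply: contrapT => h.
have [st|st] := eqVneq s t.
  by have [u hu] := sgn_nontrivial R _ _ s0; apply: h; exists u; rewrite -st.
have {h} : \sum_u (1 - sgn R s u) * (1 - sgn R t u) = 0.
  apply: big1 => u _.
  have [->|su] := sgn_pm1 R _ s u; first by rewrite subrr mul0r.
  have [->|tu] := sgn_pm1 R _ t u; first by rewrite subrr mulr0.
  by case: h; exists u.
rewrite (eq_bigr (fun u => 1 - sgn R s u - sgn R t u + sgn R (s + t) u)); last first.
  move=> u _; rewrite [sgn R (s + t) u]sgnC sgnD ![sgn R u _]sgnC.
  by rewrite mulrBl mul1r mulrBr mulr1 opprB addrA addrAC [1 - _ - _]addrAC.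
rewrite big_split !sumrB /= !sum_sgn ?subr0 ?addr0 ?pidx_add_eq0 //.
by move/eqP; rewrite sumr_const pnatr_eq0 => /eqP/card0_eq /(_ 0).
Qed.

(** * Paulis are pairwise non-proportional, span all matrices, and have scalar commutant *)

Lemma sigma_neq0 (R : realType) n (s : pidx n) : sigma R s != 0.
Proof.
apply/eqP => s0; have := sigma_sq R _ s; rewrite s0 mul0mx.
have h : (0 < 2 ^ n)%N by rewrite expn_gt0.
move/matrixP/(_ (Ordinal h) (Ordinal h))/eqP.
by rewrite !mxE eqxx eq_sym oner_eq0.
Qed.

(** Proportional nonzero matrices have the same commutation sign with every Pauli, whereas for
    [s != t] some [u] anticommutes with [s + t] and so has opposite signs with [s] and [t]. *)
Lemma sigma_inj_phase (R : realType) n (s t : pidx n) (c : R[i]) :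
  sigma R s = c *: sigma R t -> s = t.
Proof.
move=> h; apply/eqP; rewrite -pidx_add_eq0; apply/negPn/negP => st0.
have [u hu] := sgn_nontrivial R _ _ st0.
have := sigma_comm R _ s u.
rewrite {1 2}h -scalemxAl -scalemxAr sigma_comm -[sigma R u *m sigma R t]scale1r.
rewrite !scalerA mulr1 => /eqP; rewrite -subr_eq0 -scalerBl scaler_eq0.
have -> : (sigma R u *m sigma R t == 0) = false.
  by rewrite sigmaM scaler_eq0 -normr_eq0 norm_phase oner_eq0 (negPf (sigma_neq0 _ _ _)).
rewrite orbF mulr1 [_ * c]mulrC -mulrBr mulf_eq0 subr_eq0; case/orP.
  by move=> /eqP c0; have := sigma_neq0 R _ s; rewrite h c0 scale0r eqxx.
move: hu; rewrite sgnC sgnD ![sgn R u _]sgnC => hu /eqP e; move/eqP: hu.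
by rewrite e; have [->|->] := sgn_pm1 R _ s u;
  rewrite ?mulr1 ?mulrNN ?mulr1 eq_sym eqNr oner_eq0.
Qed.

Lemma pauli1_span (R : realType) (M : 'M[R[i]]_2) :
  exists c : bool * bool -> R[i], M = \sum_x c x *: pauli1 R x.
Proof.
(* The coefficient of a Pauli $P$ in $M$ is $tr(PM)/2$. *)
pose c (x : bool * bool) := 2^-1 * match x with
  | (false, false) => M 0 0 + M 1 1 | (true, false) => M 0 1 + M 1 0
  | (true, true) => 'i%R * (M 0 1 - M 1 0) | _ => M 0 0 - M 1 1 end.
exists c; rewrite (eq_bigr (fun x => c (x.1, x.2) *: pauli1 R (x.1, x.2))) => [|[]] //.
rewrite -(pair_bigA _ (fun a b => c (a, b) *: pauli1 R (a, b))) /= !big_bool.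
rewrite /pauli1 /c /=.
have ii := mulCii R[i].
have ord2 (j : 'I_2) : j = 0 \/ j = 1.
  by case: j => [[|[|?]] // ?]; [left | right]; apply: val_inj.
by apply/matrixP => j k; rewrite !mxE; case: (ord2 j) => ->; case: (ord2 k) => -> /=;
  rewrite ?complexiE; field: ii.
Qed.

(** The spanning property in dual form: stated for linear maps, it passes through the induction on
    tensor factors without explicit n-qubit coefficients. *)
Lemma linear_eq0_on_sigma (R : realType) n (V : lmodType R[i])
    (f : 'M[R[i]]_(2 ^ n) -> V) :
    (forall a M N, f (a *: M + N) = a *: f M + f N) ->
    (forall s : pidx n, f (sigma R s) = 0) ->
  forall M, f M = 0.
Proof.
have lin0 (U : lmodType R[i]) (g : U -> V) :
    (forall a x y, g (a *: x + y) = a *: g x + g y) -> g 0 = 0.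
  by move=> /(_ (-1) 0 0); rewrite scaler0 addr0 scaleN1r addNr.
have linZ (U : lmodType R[i]) (g : U -> V) a x :
    (forall a x y, g (a *: x + y) = a *: g x + g y) -> g (a *: x) = a *: g x.
  by move=> gl; rewrite -[a *: x]addr0 gl lin0 ?addr0.
have lin_sum (U : lmodType R[i]) (g : U -> V) (I : finType) (c : I -> R[i]) (e : I -> U) :
    (forall a x y, g (a *: x + y) = a *: g x + g y) ->
    (forall i, g (e i) = 0) -> g (\sum_i c i *: e i) = 0.
  move=> gl ge; apply: (big_ind (fun x => g x = 0)); first exact: lin0.
    by move=> x y x0 y0; rewrite -[x]scale1r gl x0 y0 scaler0 addr0.
  by move=> i _; rewrite linZ // ge scaler0.
elim: n f => [|n IH] f fl fs M.
  have -> : M = M ord0 ord0 *: sigma R (0 : pidx 0).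
    by apply/matrixP => j k; rewrite !ord1 sigma0 !mxE mulr1.
  by rewrite linZ // fs scaler0.
pose e := esym (expnS 2 n).
(* [f] becomes a bilinear map of the first factor and the rest: the one-qubit expansion handles the
   first argument, the induction hypothesis the second. *)
pose g (S : 'M[R[i]]_2) (N : 'M[R[i]]_(2 ^ n)) := f (castmx (e, e) (S *t N)).
have gl1 N a S T : g (a *: S + T) N = a *: g S N + g T N.
  rewrite /g -fl -castmxZ -castmxD; congr (f (castmx _ _)).
  by apply/matrixP => j k; rewrite !mxE mulrDl mulrA.
have gl2 S a N K : g S (a *: N + K) = a *: g S N + g S K.
  rewrite /g -fl -castmxZ -castmxD; congr (f (castmx _ _)).
  by apply/matrixP => j k; rewrite !mxE mulrDr mulrCA.
have g0 S N : g S N = 0.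
  have [c ->] := pauli1_span R S.
  apply: (lin_sum _ (g^~ N) _ c (pauli1 R) (gl1 N)) => x.
  apply: IH => [|s]; first exact: gl2.
  rewrite -(fs [ffun j => if unlift ord0 j is Some k then s k else x]).
  congr f; rewrite [in RHS]/sigma tensorS ffunE unlift_none; congr (castmx _ (_ *t _)).
  by apply: eq_tensor => j; rewrite ffunE liftK.
(* Matrix units suffice, since each one is a Kronecker product of smaller matrix units. *)
have -> : M = \sum_(p : 'I_(2 * 2 ^ n) * 'I_(2 * 2 ^ n))
    castmx (esym e, esym e) M p.1 p.2 *: castmx (e, e) (delta_mx p.1 p.2).
  rewrite -[LHS](castmxKV e e) [X in castmx _ X]matrix_sum_delta pair_big.
  rewrite (big_morph (castmx (e, e)) (castmxD _ _ _ e) (castmx_const _ _)).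
  by apply: eq_bigr => p _; rewrite castmxZ.
apply: lin_sum => // -[j k] /=.
case: (mxtens_indexP j) => j0 j1; case: (mxtens_indexP k) => k0 k1.
rewrite -(g0 (delta_mx j0 k0) (delta_mx j1 k1)) /g; congr (f (castmx _ _)).
apply/matrixP => u v; case: (mxtens_indexP u) => u0 u1; case: (mxtens_indexP v) => v0 v1.
rewrite tensmxE !mxE !(can_eq (@mxtens_indexK _ _)) !xpair_eqE -natrM mulnb.
by rewrite andbACA.
Qed.

Lemma commute_sigma_scalar (R : realType) n (M : 'M[R[i]]_(2 ^ n)) :
  (forall s : pidx n, M *m sigma R s = sigma R s *m M) ->
  exists c, M = c%:M.
Proof.
move=> h; pose f (N : 'M[R[i]]_(2 ^ n)) := M *m N - N *m M.
have /(_ _)/eqP f0 : forall N, f N = 0.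
  apply: linear_eq0_on_sigma => [a K N|s]; last by rewrite /f h subrr.
  rewrite /f mulmxDr mulmxDl -scalemxAr -scalemxAl scalerBr opprD addrACA.
  by [].
have {}f0 N : M *m N = N *m M by apply/eqP; rewrite -subr_eq0; exact: f0.
have h0 : (0 < 2 ^ n)%N by rewrite expn_gt0.
pose o := Ordinal h0.
exists (M o o); apply/matrixP => j k.
(* Commutation with the matrix unit at [(k, o)], read at entry [(j, o)], gives [M j k] on one side
   and [M o o] on the other when [j = k], otherwise 0. *)
have /matrixP/(_ j o) := f0 (delta_mx k o).
rewrite !mxE (bigD1 k) //= big1 => [|l /negPf lk]; last by rewrite mxE lk mulr0.
rewrite mxE !eqxx mulr1 addr0 => ->.
rewrite (bigD1 o) //= big1 => [|l /negPf lo]; last by rewrite mxE lo andbF mul0r.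
by rewrite mxE eqxx andbT addr0 mulr_natl.
Qed.

(** * Conjugation by unitaries and the Clifford action on Paulis *)

Lemma heisenbergM (R : realType) n (U M N : 'M[R[i]]_(2 ^ n)) :
  U \is unitarymx ->
  heisenberg U M *m heisenberg U N = heisenberg U (M *m N).
Proof.
move=> /unitarymxP UU; rewrite /heisenberg -!mulmxA.
by rewrite [U *m (U^t* *m _)]mulmxA UU mul1mx.
Qed.

Lemma heisenberg1 (R : realType) n (U : 'M[R[i]]_(2 ^ n)) :
  U \is unitarymx -> heisenberg U 1%:M = 1%:M.
Proof. by move=> /unitarymxP UU; rewrite /heisenberg mulmx1 (mulmx1C UU). Qed.

Lemma heisenbergZ (R : realType) n (U M : 'M[R[i]]_(2 ^ n)) c :
  heisenberg U (c *: M) = c *: heisenberg U M.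
Proof. by rewrite /heisenberg -scalemxAr -scalemxAl. Qed.

Lemma trCmxM (R : realType) n (M N : 'M[R[i]]_n) :
  (M *m N)^t* = N^t* *m M^t*.
Proof. by rewrite trmx_mul map_mxM. Qed.

Lemma trCmxZ (R : realType) n c (M : 'M[R[i]]_n) :
  (c *: M)^t* = Num.conj c *: M^t*.
Proof. by apply/matrixP => j k; rewrite !mxE rmorphM. Qed.

Lemma heisenberg_mul (R : realType) n (V U M : 'M[R[i]]_(2 ^ n)) :
  heisenberg (V *m U) M = heisenberg U (heisenberg V M).
Proof. by rewrite /heisenberg trCmxM !mulmxA. Qed.

Lemma norm1_conjK (R : realType) (c : R[i]) : `|c| = 1 -> c * Num.conj c = 1.
Proof. by move=> c1; rewrite -normCK c1 expr1n. Qed.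

Lemma heisenberg_phase (R : realType) n (U M : 'M[R[i]]_(2 ^ n)) c :
  `|c| = 1 -> heisenberg (c *: U) M = heisenberg U M.
Proof.
move=> c1; rewrite /heisenberg trCmxZ -!scalemxAl -scalemxAr scalerA.
by rewrite mulrC norm1_conjK // scale1r.
Qed.

Lemma clifford_action (R : realType) n (U : 'M[R[i]]_(2 ^ n)) (s : pidx n) :
  clifford U -> exists c t, `|c| = 1 /\ heisenberg U (sigma R s) = c *: sigma R t.
Proof.
case=> _ /(_ (sigma R s)) []; first by apply/pauliP; exists s.
by move=> c [Q [c1 /pauliP [t ->] h]]; exists c, t.
Qed.

Lemma cliffordP (R : realType) n (U : 'M[R[i]]_(2 ^ n)) :
  U \is unitarymx ->
  (forall s : pidx n, exists c t,
     `|c| = 1 /\ heisenberg U (sigma R s) = c *: sigma R t) ->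
  clifford U.
Proof.
move=> Uu h; split=> // P /pauliP [s ->]; have [c [t [c1 e]]] := h s.
by exists c, (sigma R t); split => //; apply/pauliP; exists t.
Qed.

Lemma norm1_neq0 (R : realType) (c : R[i]) : `|c| = 1 -> c != 0.
Proof. by move=> c1; rewrite -normr_eq0 c1 oner_eq0. Qed.

Lemma scaled_sigma_inj (R : realType) n (s t : pidx n) (b c : R[i]) :
  `|b| = 1 -> b *: sigma R s = c *: sigma R t -> s = t.
Proof.
move=> /norm1_neq0 b0 h; apply: (sigma_inj_phase _ _ _ _ (b^-1 * c)).
by rewrite -scalerA -h scalerA mulVf ?scale1r.
Qed.

Lemma scaled_sigma_conj (R : realType) n (a p : pidx n) (c : R[i]) :
  `|c| = 1 ->
  (c *: sigma R p) *m sigma R a *m (c *: sigma R p)^t* = sgn R a p *: sigma R a.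
Proof.
move=> c1; rewrite trCmxZ sigma_adj -!scalemxAl -scalemxAr scalerA norm1_conjK //.
by rewrite scale1r sigma_comm -scalemxAl -mulmxA sigma_sq mulmx1 sgnC.
Qed.

Lemma normalized_trace (R : realType) n (c : R[i]) :
  (2 ^ n)%:R^-1 * \tr (c *: 1%:M : 'M_(2 ^ n)) = c.
Proof.
rewrite mxtraceZ mxtrace1 mulrCA mulVf ?mulr1 //.
by rewrite pnatr_eq0 -lt0n expn_gt0.
Qed.

(** * The four-point correlator and the reduction from eight points to four *)

Definition otoc4 (R : realType) n (A O U : 'M[R[i]]_(2 ^ n)) : R[i] :=
  (2 ^ n)%:R^-1 * \tr (A *m heisenberg U O *m A *m (heisenberg U O)^t*).

Arguments otoc4 {R n} A O U.

(** Conjugating [sigma R a] by the evolved Pauli returns it up to the sign, and its square is the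
    identity. The second [A] in [otoc4] stands for the adjoint, Paulis being Hermitian. *)
Lemma otoc4_sgn (R : realType) n (a t p : pidx n) (U : 'M[R[i]]_(2 ^ n)) c :
  `|c| = 1 -> heisenberg U (sigma R t) = c *: sigma R p ->
  otoc4 (sigma R a) (sigma R t) U = sgn R a p.
Proof.
move=> c1 h; rewrite /otoc4 h -!mulmxA [_ *m (sigma R a *m _)]mulmxA.
by rewrite scaled_sigma_conj // -scalemxAr sigma_sq normalized_trace.
Qed.

(** The word is a nest of conjugations of the inner [A] by the evolved [D], by [C] and by the
    evolved [B], each contributing one sign. The two signs of the evolved Paulis combine into the
    sign for their product, the evolved [BD]. *)
Lemma otoc8_otoc4 (R : realType) n (a b c d : pidx n) (U : 'M[R[i]]_(2 ^ n)) :
  clifford U ->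
  otoc8 (sigma R a) (sigma R b) (sigma R c) (sigma R d) U =
  sgn R a c * otoc4 (sigma R a) (sigma R (b + d)) U.
Proof.
move=> Ucl; have [Uu _] := Ucl.
have [x [p [x1 hb]]] := clifford_action _ _ _ b Ucl.
have [y [q [y1 hd]]] := clifford_action _ _ _ d Ucl.
have [z [r [z1 hbd]]] := clifford_action _ _ _ (b + d) Ucl.
(* Conjugation is multiplicative, so the image of [b + d] is, up to phase, the product of the images
   of [b] and [d]. *)
have rE : r = p + q.
  apply: (scaled_sigma_inj _ _ _ _ (phase R b d * z) (x * y * phase R p q)).
    by rewrite normrM norm_phase z1 mulr1.
  rewrite -!scalerA -hbd -sigmaM -heisenbergZ -sigmaM -heisenbergM // hb hd.
  by rewrite -scalemxAl -scalemxAr.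
rewrite (otoc4_sgn _ _ _ _ _ _ _ z1 hbd) rE sgnD /otoc8 hb hd !sigma_adj.
have -> : sigma R a *m (x *: sigma R p) *m sigma R c *m (y *: sigma R q) *m
    sigma R a *m (y *: sigma R q)^t* *m sigma R c *m (x *: sigma R p)^t* =
    sigma R a *m ((x *: sigma R p) *m (sigma R c *m ((y *: sigma R q) *m
    sigma R a *m (y *: sigma R q)^t*) *m sigma R c) *m (x *: sigma R p)^t*).
  by rewrite !mulmxA.
have hc k : sigma R c *m (k *: sigma R a) *m sigma R c = (k * sgn R a c) *: sigma R a.
  have := scaled_sigma_conj R n a c 1 (normr1 _); rewrite scale1r sigma_adj.
  by rewrite -scalemxAr -scalemxAl -scalerA => ->.
rewrite scaled_sigma_conj // hc -scalemxAr -scalemxAl scaled_sigma_conj //.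
by rewrite scalerA -scalemxAr sigma_sq normalized_trace mulrAC mulrA mulrC
  [sgn R a q * _]mulrC mulrA.
Qed.

(** [U] permutes the Paulis up to phase, so the sum is a reindexed full character sum. *)
Lemma sum_otoc4 (R : realType) n (a : pidx n) (U : 'M[R[i]]_(2 ^ n)) :
  clifford U -> a != 0 ->
  \sum_t otoc4 (sigma R a) (sigma R t) U = 0.
Proof.
move=> Ucl a0.
have /choice [w hw] : forall t : pidx n, exists w : R[i] * pidx n,
    `|w.1| = 1 /\ heisenberg U (sigma R t) = w.1 *: sigma R w.2.
  by move=> t; have [c [p h]] := clifford_action _ _ _ t Ucl; exists (c, p).
have w_inj : injective (fun t => (w t).2).
  move=> s t /= e; have [[s1 hs] [t1 ht]] := (hw s, hw t).
  (* Cross-multiplying by the two phases makes the images of [sigma R s] and [sigma R t] equal. *)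
  apply: (scaled_sigma_inj _ _ _ _ (w t).1 (w s).1) => //.
  have [Uu _] := Ucl; have UU := unitarymxP Uu.
  have inj M N : heisenberg U M = heisenberg U N -> M = N.
    move=> /(congr1 (fun X => U *m X *m U^t*)).
    by rewrite /heisenberg !mulmxA UU !mul1mx -!mulmxA UU !mulmx1.
  by apply: inj; rewrite !heisenbergZ hs ht !scalerA mulrC e.
rewrite -[RHS](sum_sgn R _ a) // [RHS](reindex_inj w_inj).
by apply: eq_bigr => t _; have [c1 h] := hw t; apply: otoc4_sgn h.
Qed.

Lemma otoc4_id (R : realType) n (a : pidx n) (U : 'M[R[i]]_(2 ^ n)) :
  U \is unitarymx -> otoc4 (sigma R a) (sigma R 0) U = 1.
Proof.
move=> Uu; rewrite (otoc4_sgn _ _ _ _ 0 _ 1) ?normr1 //.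
  by rewrite /sgn big1 // => j _; rewrite ffunE /sgn1 !andbF expr0.
by rewrite scale1r sigma0 heisenberg1.
Qed.

(** * Group structure of the Cliffords modulo phase *)

Lemma phase_class_refl (R : realType) n (U : 'M[R[i]]_(2 ^ n)) : phase_class U U.
Proof. by exists 1; rewrite ?normr1 ?scale1r. Qed.

Lemma phase_classZ (R : realType) n (U : 'M[R[i]]_(2 ^ n)) c :
  `|c| = 1 -> phase_class (c *: U) = phase_class U.
Proof.
move=> c1; apply/seteqP; split=> V [b b1 ->].
  by exists (b * c); rewrite ?normrM ?b1 ?c1 ?mulr1 ?scalerA.
exists (b / c); first by rewrite normrM normfV b1 c1 invr1 mulr1.
by rewrite scalerA divfK // norm1_neq0.
Qed.

Lemma clifford_phase (R : realType) n (U : 'M[R[i]]_(2 ^ n)) c :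
  `|c| = 1 -> clifford U -> clifford (c *: U).
Proof.
move=> c1 Ucl; apply: cliffordP => [|s]; last first.
  by rewrite heisenberg_phase //; exact: clifford_action.
have [/unitarymxP UU _] := Ucl; apply/unitarymxP.
by rewrite trCmxZ -scalemxAl -scalemxAr scalerA norm1_conjK // scale1r.
Qed.

Lemma clifford_mul (R : realType) n (V U : 'M[R[i]]_(2 ^ n)) :
  clifford V -> clifford U -> clifford (V *m U).
Proof.
move=> Vcl Ucl; apply: cliffordP => [|s].
  by apply: mul_unitarymx; [case: Vcl | case: Ucl].
have [c [t [c1 hV]]] := clifford_action _ _ _ s Vcl.
have [b [u [b1 hU]]] := clifford_action _ _ _ t Ucl.
exists (c * b), u; split; first by rewrite normrM c1 b1 mulr1.
by rewrite heisenberg_mul hV heisenbergZ hU scalerA.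
Qed.

Lemma clifford1 (R : realType) n : clifford (1%:M : 'M[R[i]]_(2 ^ n)).
Proof.
apply: cliffordP => [|s].
  by apply/unitarymxP; rewrite trmx1 map_mx1 mulmx1.
exists 1, s; rewrite normr1 scale1r /heisenberg trmx1 map_mx1 mulmx1 mul1mx.
by [].
Qed.

(** Every class is nonempty, so the default 0 of [xget] is never taken and the chosen representative
    is a genuine Clifford element. *)
Lemma proj_clifford_repr (R : realType) n (K : set 'M[R[i]]_(2 ^ n)) :
  @proj_clifford R n K -> clifford (xget 0 K) /\ phase_class (xget 0 K) = K.
Proof.
case=> U Ucl <-.
have [c c1 ->] := xgetI 0 (phase_class_refl R n U).
by split; [exact: clifford_phase | rewrite phase_classZ].
Qed.

(** * Invariance of the summed four-point correlator *)

Definition otoc4_sum (R : realType) n (A O : 'M[R[i]]_(2 ^ n)) : R[i] :=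
  \sum_(K \in @proj_clifford R n) otoc4 A O (xget 0 K).

Arguments otoc4_sum {R n} A O.

(** Replacing [U] by [V *m U] evolves [heisenberg V O] in place of [O]. Left multiplication by [V]
    permutes the classes, and as [V] squares to the identity this permutation is its own inverse. *)
Lemma otoc4_sum_conj (R : realType) n (V A O P : 'M[R[i]]_(2 ^ n)) :
  clifford V -> V *m V = 1%:M -> heisenberg V O = P ->
  otoc4_sum A P = otoc4_sum A O.
Proof.
move=> Vcl VV <-; rewrite /otoc4_sum.
pose h (K : set 'M[R[i]]_(2 ^ n)) := phase_class (V *m xget 0 K).
have hP K : @proj_clifford R n K -> @proj_clifford R n (h K).
  move=> /proj_clifford_repr [Kcl _].
  by exists (V *m xget 0 K) => //; exact: clifford_mul.
have hx K : exists2 c : R[i], `|c| = 1 & xget 0 (h K) = c *: (V *m xget 0 K).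
  exact: (xgetI 0 (phase_class_refl R n (V *m xget 0 K))).
have hK K : @proj_clifford R n K -> h (h K) = K.
  move=> KP; rewrite {1}/h; have [c c1 ->] := hx K.
  rewrite -scalemxAr phase_classZ // mulmxA VV mul1mx.
  by have [] := proj_clifford_repr _ _ _ KP.
rewrite [RHS](reindex_fsbig h (@proj_clifford R n)); last first.
  split=> [K /hP //|K L|K KP].
    by rewrite !inE => KP LP e; rewrite -(hK K) // e hK.
  by exists (h K); [exact: hP | exact: hK].
apply: eq_fsbigr => K _; have [c c1 ->] := hx K.
by rewrite /otoc4 heisenberg_phase // heisenberg_mul.
Qed.

(* The witness is the symplectic transvection (P + Q) / sqrt 2 of the
   anticommuting Paulis P and Q indexed by s and t. *)
Lemma transvection (R : realType) n (s t : pidx n) :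
  sgn R s t = -1 -> exists V : 'M[R[i]]_(2 ^ n),
  [/\ clifford V, V *m V = 1%:M & heisenberg V (sigma R s) = sigma R t].
Proof.
move=> st; pose k : R[i] := (sqrtC 2)^-1.
have kk : k * k = 2^-1 by rewrite -invfM -expr2 sqrtCK.
have kJ : Num.conj k = k.
  by apply: conj_Creal; rewrite ger0_real // invr_ge0 sqrtC_ge0.
pose V := k *: (sigma R s + sigma R t); exists V.
have VA : V^t* = V.
  by rewrite trCmxZ kJ raddfD /= map_mxD !sigma_adj.
have ts : sigma R t *m sigma R s = - (sigma R s *m sigma R t).
  by rewrite sigma_comm sgnC st scaleN1r.
(* With [sigma R r] pulled to the left, equal signs kill the product term and leave it fixed up to
   sign; opposite signs kill the scalar term and multiply it by the Pauli of [s + t] up to phase. *)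
have VE r : heisenberg V (sigma R r) = 2^-1 *: (sigma R r *m
    ((sgn R s r + sgn R t r)%:M +
     (sgn R s r - sgn R t r) *: (sigma R s *m sigma R t))).
  rewrite /heisenberg VA /V -!scalemxAl -scalemxAr scalerA kk; congr (_ *: _).
  rewrite mulmxDl [sigma R s *m sigma R r]sigma_comm [sigma R t *m sigma R r]sigma_comm.
  rewrite !scalemxAr -mulmxDr -mulmxA; congr (_ *m _).
  rewrite mulmxDl !mulmxDr -!scalemxAl !sigma_sq ts scalerN scalerBl.
  rewrite !scalemx1 raddfD /=.
  by rewrite [- _ + _]addrC addrACA mulmxBr -!scalemxAr.
have VV : V *m V = 1%:M.
  rewrite -scalemxAl -scalemxAr scalerA kk mulmxDl !mulmxDr !sigma_sq ts.
  rewrite addrA addrK -mulr2n -[_%:M *+ 2]scaler_nat scalerA mulVf ?scale1r //.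
  by rewrite pnatr_eq0.
have two : (2 : R[i])^-1 * 2 = 1 by rewrite mulVf // pnatr_eq0.
split=> //; last first.
  have ss : sgn R s s = 1.
    by rewrite /sgn big1 // => j _; rewrite /sgn1; case: (s j) => [[] []].
  rewrite VE ss sgnC st subrr opprK raddf0 add0r -scalemxAr mulmxA sigma_sq.
  by rewrite mul1mx scalerA two scale1r.
apply: cliffordP => [|r]; first by apply/unitarymxP; rewrite VA.
have same : sgn R s r = sgn R t r -> heisenberg V (sigma R r) = sgn R s r *: sigma R r.
  move=> e; rewrite VE -e subrr scale0r addr0 mul_mx_scalar scalerA.
  by rewrite -mulr2n -[sgn R s r *+ 2]mulr_natl mulrA two mul1r.
have diff : sgn R s r = - sgn R t r -> heisenberg V (sigma R r) =
    (sgn R s r * phase R s t * phase R r (s + t)) *: sigma R (r + (s + t)).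
  move=> e; rewrite VE e addNr raddf0 add0r -e -mulr2n -scalemxAr scalerA.
  by rewrite -[sgn R s r *+ 2]mulr_natl mulrA two mul1r sigmaM -scalemxAr sigmaM !scalerA.
have n1 (x y : pidx n) : `|sgn R x y| = 1.
  by have [->|->] := sgn_pm1 R _ x y; rewrite ?normrN normr1.
have [e|e] : sgn R s r = sgn R t r \/ sgn R s r = - sgn R t r.
  by have [->|->] := sgn_pm1 R _ s r; have [->|->] := sgn_pm1 R _ t r;
     rewrite ?opprK; auto.
- by exists (sgn R s r), r; rewrite n1 same.
- exists (sgn R s r * phase R s t * phase R r (s + t)), (r + (s + t)).
  by rewrite diff // !normrM !norm_phase n1 !mulr1.
Qed.

Lemma otoc4_sum_const (R : realType) n (A : 'M[R[i]]_(2 ^ n)) (s t : pidx n) :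
  s != 0 -> t != 0 ->
  otoc4_sum A (sigma R s) = otoc4_sum A (sigma R t).
Proof.
move=> s0 t0; have [u [su tu]] := sgn_separate R _ _ _ s0 t0.
have [V [Vcl VV Vs]] := transvection _ _ _ _ su.
have [W [Wcl WW Wt]] := transvection _ _ _ _ tu.
have eV := otoc4_sum_conj _ _ V A _ _ Vcl VV Vs.
have eW := otoc4_sum_conj _ _ W A _ _ Wcl WW Wt.
exact (etrans (esym eV) eW).
Qed.

(** * Finiteness of the projective Clifford group *)

Lemma clifford_sign (R : realType) n (U : 'M[R[i]]_(2 ^ n)) (s : pidx n) :
  clifford U -> exists w : pidx n * bool,
  heisenberg U (sigma R s) = (-1) ^+ w.2 *: sigma R w.1.
Proof.
move=> Ucl; have [c [t [c1 h]]] := clifford_action _ _ _ s Ucl.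
(* A Pauli squares to the identity, hence so does its image, which forces the phase to be a sign. *)
have [Uu _] := Ucl; have : c ^+ 2 = 1.
  have e : c ^+ 2 *: (1%:M : 'M_(2 ^ n)) = 1 *: 1%:M.
    transitivity (heisenberg U (sigma R s) *m heisenberg U (sigma R s)).
      by rewrite h -scalemxAl -scalemxAr scalerA sigma_sq.
    by rewrite heisenbergM // sigma_sq heisenberg1 // scale1r.
  by rewrite -[LHS](normalized_trace R n) e normalized_trace.
move/eqP; rewrite sqrf_eq1 => /orP[] /eqP cE.
  by exists (t, false); rewrite h cE.
by exists (t, true); rewrite h cE.
Qed.

(** [V *m U^t*] commutes with every Pauli, hence is a scalar [z]; unitarity gives it modulus 1. *)
Lemma phase_class_action (R : realType) n (U V : 'M[R[i]]_(2 ^ n)) :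
  U \is unitarymx -> V \is unitarymx ->
  (forall s : pidx n, heisenberg U (sigma R s) = heisenberg V (sigma R s)) ->
  phase_class U V.
Proof.
move=> /unitarymxP UU /unitarymxP VV UV.
have [s|z Wz] := commute_sigma_scalar R n (V *m U^t*).
  have /(congr1 (fun X => V *m X *m U^t*)) := UV s.
  rewrite /heisenberg !mulmxA VV mul1mx.
  by rewrite -[_ *m U *m U^t*]mulmxA UU mulmx1 => ->.
have Vz : V = z *: U.
  by rewrite -mul_scalar_mx -Wz -mulmxA (mulmx1C UU) mulmx1.
have e : `|z| ^+ 2 *: (1%:M : 'M_(2 ^ n)) = 1 *: 1%:M.
  by rewrite normCK scale1r -[RHS]VV Vz trCmxZ -scalemxAl -scalemxAr UU scalerA.
exists z => //; apply/eqP; rewrite -(@sqrp_eq1 _ `|z|) //; apply/eqP.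
by rewrite -[LHS](normalized_trace R n) e normalized_trace.
Qed.

Lemma finite_proj_clifford (R : realType) n : finite_set (@proj_clifford R n).
Proof.
(* [act g] collects the Cliffords inducing the signed map [g]. There are finitely many [g], and each
   class comes from the chosen element of some [act g]; an empty [act g] only adds an extra set to
   the finite cover. *)
pose act (g : {ffun pidx n -> pidx n * bool}) : set 'M[R[i]]_(2 ^ n) :=
  [set U | clifford U /\
    forall s, heisenberg U (sigma R s) = (-1) ^+ (g s).2 *: sigma R (g s).1].
apply: (@sub_finite_set _ _ [set phase_class (xget 0 (act g)) | g in setT]);
  last by apply: finite_image; exact: finite_finset.
move=> _ [U Ucl <-].
have /choice [w hw] := fun s => clifford_sign R n U s Ucl.
have Ug : act [ffun s => w s] U by split=> // s; rewrite ffunE.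
exists [ffun s => w s] => //; have [Vcl Vg] := xgetI 0 Ug.
have [c c1 ->] : phase_class U (xget 0 (act [ffun s => w s])).
  apply: phase_class_action => [||s]; [by case: Ucl | by case: Vcl |].
  by rewrite Vg; have [_ ->] := Ug.
exact: phase_classZ.
Qed.

(** * The value of K and the final average *)

Lemma pauliK_sigma (R : realType) n (a c : pidx n) :
  pauliK (sigma R a) ((sigma R c)^t*) = sgn R a c.
Proof.
rewrite /pauliK sigma_adj.
have h : sigma R c *m sigma R a *m sigma R c = sgn R a c *: sigma R a.
  have := scaled_sigma_conj R n a c 1 (normr1 _).
  by rewrite scale1r sigma_adj.
apply: xget_unique => /=; first by rewrite sigma_adj; split => //; exact: sgn_pm1.
move=> k [_]; rewrite sigma_adj h => /eqP.
rewrite -subr_eq0 -scalerBl scaler_eq0 (negPf (sigma_neq0 _ _ _)) orbF subr_eq0.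
by move/eqP.
Qed.

Theorem mainTheorem9 (R : realType) (n : nat) (A B C D : 'M[R[i]]_(2 ^ n))
    (hA : pauli A) (hB : pauli B) (hC : pauli C) (hD : pauli D)
    (hA1 : A <> 1%:M) (hB1 : B <> 1%:M) (hC1 : C <> 1%:M) (hD1 : D <> 1%:M)
    (hAC : A *m C <> 1%:M) (hBD : B *m D <> 1%:M) :
  clifford_avg (otoc8 A B C D) =
    - pauliK A (C^t*) / (((2 ^ n) ^ 2)%:R - 1).
Proof.
move: hA hB hC hD => /pauliP [a Aa] /pauliP [b Bb] /pauliP [c Cc] /pauliP [d Dd].
have a0 : a != 0 by apply/eqP => a0; apply: hA1; rewrite Aa a0 sigma0.
have bd0 : b + d != 0.
  by rewrite pidx_add_eq0; apply/eqP => bd; apply: hBD; rewrite Bb Dd bd sigma_sq.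
rewrite Aa Cc pauliK_sigma /clifford_avg Bb Dd.
set S := @proj_clifford R n; have fS : finite_set S := finite_proj_clifford R n.
rewrite (eq_fsbigr (fun K =>
  sgn R a c * otoc4 (sigma R a) (sigma R (b + d)) (xget 0 K))); last first.
  by move=> K; rewrite inE => /proj_clifford_repr [Kcl _]; exact: otoc8_otoc4.
rewrite -mulr_fsumr.
pose f t := otoc4_sum (sigma R a) (sigma R t).
rewrite [X in _ * X / _](_ : _ = f (b + d)) //; set N := #|` _|.
have f0 : f 0 = N%:R.
  rewrite /f /otoc4_sum (eq_fsbigr (fun=> 1)); last first.
    move=> K; rewrite inE => /proj_clifford_repr [[Ku _] _]; exact: otoc4_id.
  by rewrite fsbig_finite // big_const_seq count_predT iter_addr_0.
(* Exchanging the sums lets the Pauli sum vanish separately at each Clifford class. *)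
have sumf : \sum_t f t = 0.
  rewrite (eq_bigr (fun t =>
    \sum_(K <- fset_set S) otoc4 (sigma R a) (sigma R t) (xget 0 K))); last first.
    by move=> t _; rewrite /f /otoc4_sum fsbig_finite.
  rewrite exchange_big big1_seq // => K /andP[_]; rewrite in_fset_set // inE.
  by move=> /proj_clifford_repr [Kcl _]; exact: sum_otoc4.
(* The identity contributes [N]; the other $4^n-1=d^2-1$ indices all contribute the same value
   [f (b + d)]. *)
have fN : N%:R + (((2 ^ n) ^ 2)%:R - 1) * f (b + d) = 0.
  rewrite -[RHS]sumf [RHS](bigD1 (0 : pidx n)) //= f0; congr (_ + _).
  rewrite (eq_bigr (fun=> f (b + d))) => [|t t0]; last exact: otoc4_sum_const.
  rewrite sumr_const -[RHS]mulr_natl; congr (_ * _).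
  have -> : ((2 ^ n) ^ 2)%N = #|predC1 (0 : pidx n)|.+1.
    rewrite cardC1 prednK; last by apply/card_gt0P; exists 0.
    by rewrite card_ffun card_prod card_bool card_ord -expnM mulnC expnM.
  by rewrite -natr1 addrK.
(* The class of the identity shows that the group is nonempty. *)
have N0 : N%:R != 0 :> R[i].
  rewrite pnatr_eq0 cardfs_eq0; apply/eqP => /(fset_set_set0 fS) S0.
  have : S (phase_class 1%:M) by exists 1%:M => //; exact: clifford1.
  by rewrite S0.
(* If $d^2=1$, the relation [fN] would force [N] to vanish. *)
have d0 : ((2 ^ n) ^ 2)%:R - 1 != 0 :> R[i].
  by apply/eqP => d0; move: fN N0; rewrite d0 mul0r addr0 => ->; rewrite eqxx.
have -> : f (b + d) = - N%:R / (((2 ^ n) ^ 2)%:R - 1).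
  by apply: (canRL (mulfK d0)); apply/eqP; rewrite -addr_eq0 addrC mulrC fN.
by rewrite -mulrA [_ / _ / _]mulrAC mulNr divff // mulrA mulrN1.
Qed.
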